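(* Let $G=(V,E)$ be a strongly connected finite directed multigraph (parallel edges between the same ordered pair of vertices are allowed and are considered distinct). Then a deadlock-free routing for $G$ exists if and only if there is a vertex $v\in V$ and two edge-disjoint subsets $T_{\mathrm{in}},T_{\mathrm{out}}\subseteq E$ such that $T_{\mathrm{in}}$ forms a spanning directed tree directed into $v$ (every vertex has a directed path to $v$ using only edges of $T_{\mathrm{in}}$) and $T_{\mathrm{out}}$ forms a spanning directed tree directed away from $v$ (every vertex is reachable from $v$ by a directed path using only edges of $T_{\mathrm{out}}$).
   Context: A network is a strongly connected directed multigraph $G=(V,E)$ whose vertices are nodes and whose edges are communication channels. A routing for $G$ is a deterministic assignment, to each ordered pair $(a,b)$ of distinct vertices, of a directed path in $G$ from $a$ to $b$ (depending only on the source and the destination). Given a routing, there is a dependency from edge $e_1$ to edge $e_2$ if some routing path uses $e_2$ immediately after $e_1$. The dependency graph is the directed graph whose vertex set is $E$ and whose edges are these dependencies. A routing is deadlock-free if its dependency graph is acyclic (this is the Dally–Seitz characterization of deadlock freedom). No virtual channels may be added: the routing must use the edges of $G$ as given. No efficiency requirement (e.g. shortest paths) is imposed on the routing. *)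

(* Defs.v *)
From mathcomp Require Import all_boot.

Set Implicit Arguments.
Unset Strict Implicit.
Unset Printing Implicit Defensive.

Record multigraph := Multigraph {
  vertex : finType;
  edge : finType;
  src : edge -> vertex;
  tgt : edge -> vertex
}.

(* [A] is a type of arcs, oriented by [s] and [t]; it is instantiated below with
   the edges of a multigraph, and with its edges traversed in either direction. *)
Section Walks.
Variables (V : eqType) (A : Type) (s t : A -> V).

Fixpoint walk (a : V) (p : seq A) (b : V) : bool :=
  if p is e :: q then (s e == a) && walk (t e) q b else a == b.

Definition simple_path (a : V) (p : seq A) (b : V) : bool :=
  walk a p b && uniq (a :: map t p).

End Walks.

Section Routing.
Variable G : multigraph.
Notation V := (vertex G).
Notation E := (edge G).

Definition dipath (a : V) (p : seq E) (b : V) : bool :=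
  simple_path (@src G) (@tgt G) a p b.

(* A strongly connected graph has at least one vertex. *)
Definition strongly_connected : Prop :=
  0 < #|V| /\ forall a b : V, exists p, dipath a p b.

(* The values [r a a] are irrelevant: a routing is only constrained, and only
   creates dependencies, on pairs of distinct vertices. *)
Definition is_routing (r : V -> V -> seq E) : Prop :=
  forall a b : V, a != b -> dipath a (r a b) b.

Definition dependency (r : V -> V -> seq E) : rel E :=
  [rel e1 e2 | [exists a : V, exists b : V,
                  (a != b) && infix [:: e1; e2] (r a b)]].

Definition acyclic (T : Type) (e : rel T) : Prop :=
  forall c : seq T, cycle e c -> c = [::].

Definition deadlock_free (r : V -> V -> seq E) : Prop :=
  acyclic (dependency r).

(* Undirected traversals: [(e, true)] follows [e] from [src e] to [tgt e],
   [(e, false)] follows it backwards. *)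
Definition usrc (x : E * bool) : V := if x.2 then src x.1 else tgt x.1.
Definition utgt (x : E * bool) : V := if x.2 then tgt x.1 else src x.1.

Definition uconnected (T : {set E}) : Prop :=
  forall a b : V, exists p : seq (E * bool),
    simple_path usrc utgt a p b /\ {subset unzip1 p <= T}.

(* A cycle is a nonempty closed walk with distinct edges and distinct vertices;
   [map utgt c] lists the vertices of a closed walk [c], base point once.
   Loops and pairs of (anti)parallel edges are cycles. *)
Definition uacyclic (T : {set E}) : Prop :=
  forall (a : V) (c : seq (E * bool)),
    walk usrc utgt a c a -> {subset unzip1 c <= T} ->
    uniq (unzip1 c) -> uniq (map utgt c) -> c = [::].

Definition spanning_tree (T : {set E}) : Prop := uconnected T /\ uacyclic T.

Definition spanning_tree_into (v : V) (T : {set E}) : Prop :=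
  spanning_tree T /\
  forall u : V, exists p, dipath u p v /\ {subset p <= T}.

Definition spanning_tree_from (v : V) (T : {set E}) : Prop :=
  spanning_tree T /\
  forall u : V, exists p, dipath v p u /\ {subset p <= T}.

End Routing.

(* Main.v *)
Require Import Defs.
From mathcomp Require Import all_boot.

Set Implicit Arguments.
Unset Strict Implicit.
Unset Printing Implicit Defensive.

(** Both directions rest on ranking the edges.  Given the two trees, the route
    from [a] to [b] climbs [Tin] to the root and then descends [Tout], with loops
    cut out; ranks increase along it when [Tin] is ranked towards the root,
    [Tout] away from it, and [Tin] comes before [Tout].

    Conversely, let [D] be a smallest set of edges that is closed under
    predecessors for the dependency relation and in which some vertex [v] can be
    reached from everywhere.  No edge of [D] leaves [v]: otherwise follow
    dependencies inside [D] from such an edge to a maximal edge [g]; every vertex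
    still reaches the source of [g] without [g], so [D :\ g] contradicts
    minimality.  Hence every route from [v] starts, and therefore stays, outside
    [D], and the trees are found in [D] and in its complement. *)

(** * Sequences and finite relations *)

Lemma map_uniq_inj_in (T1 T2 : eqType) (f : T1 -> T2) (s : seq T1) :
  uniq (map f s) -> {in s &, injective f}.
Proof.
elim: s => // x s IHs /= /andP[fx_notin uniq_fs] y z; rewrite !inE.
case/predU1P=> [->|ys] /predU1P[->|zs] // fyz; last exact: IHs.
- by rewrite fyz map_f in fx_notin.
- by rewrite -fyz map_f in fx_notin.
Qed.

Lemma sorted_infix2P (T : eqType) (e : rel T) (s : seq T) :
  sorted e s <-> forall x y, infix [:: x; y] s -> e x y.
Proof.
split=> [es x y /infix_sorted/(_ es)|]; first by rewrite /= andbT.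
case: s => // x0 s es; apply/(sortedP x0) => i lti; apply/es/infixP.
exists (take i (x0 :: s)), (drop i.+2 (x0 :: s)).
by rewrite /= -!drop_nth ?cat_take_drop // ltnW.
Qed.

Lemma imset_section (aT rT : finType) (f : aT -> rT) (D : {set aT}) :
  exists T : {set aT}, [/\ T \subset D, {in T &, injective f} & f @: T = f @: D].
Proof.
pose choice y := [pick x in D | f x == y].
exists [set x in D | choice (f x) == Some x].
have choiceP x : x \in D ->
    exists x', [/\ x' \in D, f x' = f x & choice (f x) = Some x'].
  move=> Dx; rewrite /choice; case: pickP => [x' /andP[Dx' /eqP fx']|/(_ x)].
    by exists x'.
  by rewrite Dx eqxx.
split.
- by apply/subsetP=> x; rewrite inE => /andP[].
- move=> x y; rewrite !inE => /andP[_ /eqP choice_x] /andP[_ /eqP choice_y] fxy.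
  by move: choice_y; rewrite -fxy choice_x => -[].
- apply/setP=> y; apply/imsetP/imsetP=> [[x]|[x Dx ->]].
    by rewrite inE => /andP[Dx _] ->; exists x.
  have [x' [Dx' fx' choice_x]] := choiceP x Dx.
  by exists x'; rewrite // inE Dx' fx' choice_x eqxx.
Qed.

Lemma ranked_acyclic (T : Type) (e : rel T) (rk : T -> nat) :
  {homo rk : x y / e x y >-> x < y} -> acyclic e.
Proof.
move=> rk_homo [//|x c] /(homo_cycle rk_homo) /= /(order_path_min ltn_trans).
by rewrite all_rcons ltnn.
Qed.

Section FiniteRelation.
Variables (T : finType) (e : rel T).

Lemma acyclic_rank :
  acyclic e -> exists rk : T -> nat, {homo rk : x y / e x y >-> x < y}.
Proof.
move=> acy; exists (fun y => #|[set x | connect e x y]|) => x y exy.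
apply/proper_card/properP; split.
  apply/subsetP=> z; rewrite !inE => zx.
  exact: connect_trans zx (connect1 exy).
exists y; rewrite inE ?connect0 //; apply/negP=> /connectP[p ep def_x].
suff /acy : cycle e (y :: p) by [].
by rewrite /= rcons_path ep -def_x.
Qed.

Lemma acyclic_maximal (D : {set T}) x :
  acyclic e -> x \in D ->
  exists g, [/\ g \in D, connect e x g & {in D, forall y, ~~ e g y}].
Proof.
move=> /acyclic_rank[rk rk_homo] Dx.
pose above := [pred y | (y \in D) && connect e x y].
have above_x : above x by rewrite /= Dx connect0.
case: (arg_maxnP rk above_x) => g /andP[Dg xg] rk_max.
exists g; split=> // y Dy; apply/negP=> egy.
suff /rk_max : above y by apply/negP; rewrite -ltnNge rk_homo.
by rewrite /= Dy (connect_trans xg (connect1 egy)).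
Qed.

(* The rank is the distance to [v]. *)
Lemma connect_descending_rank v :
  (forall x, connect e x v) ->
  exists h : T -> nat, forall x, x != v -> exists2 y, e x y & h y < h x.
Proof.
move=> to_v.
pose path_of_length x n := [exists p : n.-tuple T, path e x p && (last x p == v)].
have path_of_lengthP x p : path e x p -> last x p = v -> path_of_length x (size p).
  by move=> ep lp; apply/existsP; exists (in_tuple p); rewrite ep lp eqxx.
have ex_length x : exists n, path_of_length x n.
  by have /connectP[p ep lp] := to_v x; exists (size p); apply: path_of_lengthP.
exists (fun x => ex_minn (ex_length x)) => x xv.
case: (ex_minnP (ex_length x)) => n /existsP[p /andP[ep /eqP lp]] _.
have size_p := size_tuple p.
case: (tval p) size_p ep lp => [|y q] /= <-.
  by move=> _ def_v; rewrite def_v eqxx in xv.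
case/andP=> exy path_q last_q; exists y => //; rewrite ltnS.
by case: ex_minnP => m _; apply; apply: path_of_lengthP.
Qed.

Lemma descending_rank_connect (h : T -> nat) v :
  (forall x, x != v -> exists2 y, e x y & h y < h x) -> forall x, connect e x v.
Proof.
move=> descend x; have [n] := ubnP (h x); elim: n x => // n IHn x hx.
have [-> //|/descend[y exy hy]] := eqVneq x v.
exact: connect_trans (connect1 exy) (IHn y (leq_trans hy hx)).
Qed.

Definition down_closed (D : {set T}) : bool :=
  [forall y in D, [set x | e x y] \subset D].

Lemma down_closedP (D : {set T}) :
  reflect (forall x y, e x y -> y \in D -> x \in D) (down_closed D).
Proof.
apply: (iffP forall_inP) => [clD x y exy Dy|clD y Dy].
  by apply: (subsetP (clD y Dy)); rewrite inE.
by apply/subsetP=> x; rewrite inE => /clD; apply.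
Qed.

Lemma down_closed_connect (D : {set T}) x y :
  down_closed D -> connect e x y -> y \in D -> x \in D.
Proof.
move=> /down_closedP clD /connectP[p].
elim: p x => [|z p IHp] x /=; first by move=> _ ->.
by case/andP=> exz pz def_y Dy; apply: clD exz (IHp z pz def_y Dy).
Qed.

Lemma down_closedD1 (D : {set T}) g :
  down_closed D -> {in D, forall y, ~~ e g y} -> down_closed (D :\ g).
Proof.
move=> /down_closedP clD max_g; apply/down_closedP=> x y exy.
rewrite !inE => /andP[_ Dy].
rewrite (clD _ _ exy Dy) andbT; apply: contraTneq exy => ->; exact: max_g.
Qed.

End FiniteRelation.

(** * Walks *)

Section Walks.
Variables (V : eqType) (A : Type) (s t : A -> V).

Definition consecutive : rel A := [rel e1 e2 | t e1 == s e2].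

Lemma walk_cons a e p b :
  walk s t a (e :: p) b = [&& s e == a, path consecutive e p & t (last e p) == b].
Proof.
congr (_ && _); elim: p e => //= e' p IHp e.
by rewrite IHp andbA [s e' == _]eq_sym.
Qed.

Lemma walk_consecutive a p b : walk s t a p b -> sorted consecutive p.
Proof. by case: p => // e p; rewrite walk_cons => /and3P[]. Qed.

Lemma closed_walk_cycle a c : walk s t a c a -> cycle consecutive c.
Proof.
case: c => // e c; rewrite walk_cons => /and3P[/eqP se pc /eqP tl].
by rewrite /= rcons_path pc /consecutive /= tl se.
Qed.

Lemma walk_cat a b c p q :
  walk s t a p b -> walk s t b q c -> walk s t a (p ++ q) c.
Proof.
elim: p a => [|e p IHp] a /=; first by move=> /eqP->.
by case/andP=> -> wp wq; apply: IHp.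
Qed.

Lemma walk_vertices a p b : walk s t a p b -> a :: map t p = rcons (map s p) b.
Proof.
by elim: p a => [|e p IHp] a /=; [move=> /eqP-> | case/andP=> /eqP-> /IHp->].
Qed.

Lemma closed_walk_vertices a c : walk s t a c a -> perm_eq (map s c) (map t c).
Proof.
by move=> walk_c; rewrite -(perm_cons a) (walk_vertices walk_c) perm_sym perm_rcons.
Qed.

End Walks.

Lemma walk_rev (V : eqType) (A : Type) (s t : A -> V) a p b :
  walk s t a p b -> walk t s b (rev p) a.
Proof.
elim: p a => [|e p IHp] a /=; first by rewrite eq_sym.
case/andP=> /eqP <- /IHp wp; rewrite rev_cons -cats1.
by apply: walk_cat wp _; rewrite /= !eqxx.
Qed.

Lemma simple_path_rev (V : eqType) (A : Type) (s t : A -> V) a p b :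
  simple_path s t a p b -> simple_path t s b (rev p) a.
Proof.
case/andP=> wp; rewrite (walk_vertices wp) /simple_path walk_rev //=.
by rewrite rcons_uniq map_rev mem_rev rev_uniq.
Qed.

Section ShortenWalk.
Variables (V A : eqType) (s t : A -> V).

Lemma simple_path_suffix a b c q :
  simple_path s t c q b -> a \in c :: map t q ->
  exists2 q', subseq q' q & simple_path s t a q' b.
Proof.
elim: q c => [|e q IHq] c simple_q.
  by rewrite mem_seq1 => /eqP->; exists [::].
rewrite in_cons => /predU1P[->|a_q]; first by exists (e :: q).
have simple_tail : simple_path s t (t e) q b.
  by move: simple_q => /andP[/= /andP[_ wq] /andP[_ uq]]; rewrite /simple_path wq.
have [q' sub_q' simple_q'] := IHq _ simple_tail a_q.
by exists q' => //; apply: subseq_trans sub_q' (subseq_cons _ _).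
Qed.

Lemma walk_shorten a b p :
  walk s t a p b -> exists2 q, subseq q p & simple_path s t a q b.
Proof.
elim: p a => [|e p IHp] a /=.
  by move=> wp; exists [::]; rewrite // /simple_path /= wp.
case/andP=> /eqP se /IHp[q sub_qp simple_q].
have [a_q|a_notin_q] := boolP (a \in t e :: map t q).
  have [q' sub_q'q simple_q'] := simple_path_suffix simple_q a_q.
  exists q' => //.
  exact: subseq_trans (subseq_trans sub_q'q sub_qp) (subseq_cons _ _).
exists (e :: q); first by rewrite /= eqxx.
by move: simple_q => /andP[wq uq]; rewrite /simple_path /= se eqxx wq a_notin_q.
Qed.

End ShortenWalk.

Lemma closed_walk_peak
    (V : eqType) (A : finType) (s t : A -> V) (h : V -> nat) a c :
  walk s t a c a -> c != [::] ->
  exists x y, [/\ x \in c, y \in c, t x = s y,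
                  h (s x) <= h (t x) & h (t y) <= h (s y)].
Proof.
move=> /closed_walk_cycle; case: c => // x0 c.
move: (x0 :: c) (mem_head x0 c) => {}c x0_c cyc _.
have [y y_c top_y] : exists2 y, y \in c & {in c, forall z, h (s z) <= h (s y)}.
  by case: (arg_maxnP (fun z => h (s z)) x0_c) => y y_c top_y; exists y.
have /eqP prev_meets := prev_cycle cyc y_c.
have /eqP next_meets := next_cycle cyc y_c.
exists (prev c y), y; split=> //; first by rewrite mem_prev.
- by rewrite prev_meets top_y ?mem_prev.
- by rewrite next_meets top_y ?mem_next.
Qed.

(** * Roots *)

Local Notation diwalk := (walk (@src _) (@tgt _)).

Section Roots.
Variable G : multigraph.
Implicit Types (D T : {set edge G}) (e g : edge G) (p : seq (edge G)).
Implicit Types (x y v : vertex G) (h : vertex G -> nat).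

Definition arc D : rel (vertex G) :=
  [rel x y | [exists e in D, (src e == x) && (tgt e == y)]].

Lemma arcP D x y :
  reflect (exists2 e, e \in D & src e = x /\ tgt e = y) (arc D x y).
Proof.
apply: (iffP exists_inP) => [[e De /andP[/eqP se /eqP te]]|[e De [se te]]].
  by exists e.
by exists e; rewrite // se te !eqxx.
Qed.

Lemma arc_edge D e : e \in D -> arc D (src e) (tgt e).
Proof. by move=> De; apply/arcP; exists e. Qed.

Lemma connect_arcP D x y :
  reflect (exists2 p, diwalk x p y & all [in D] p) (connect (arc D) x y).
Proof.
apply: (iffP idP) => [/connectP[q]|[p]].
  elim: q x => [|z q IHq] x /=; first by move=> _ ->; exists [::]; rewrite /= ?eqxx.
  case/andP=> /arcP[e De [se te]] /IHq/[apply] -[p wp Dp].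
  by exists (e :: p); rewrite /= ?se ?te ?eqxx ?De.
elim: p x => [|e p IHp] x /=; first by move=> /eqP->.
case/andP=> /eqP <- wp /andP[De Dp].
exact: connect_trans (connect1 (arc_edge De)) (IHp _ wp Dp).
Qed.

Lemma connect_dipathP D x y :
  reflect (exists p, dipath x p y /\ {subset p <= D}) (connect (arc D) x y).
Proof.
apply: (iffP (connect_arcP D x y)) => [[p wp /allP Dp]|].
  have [q sub_qp simple_q] := walk_shorten wp.
  by exists q; split=> // e /(mem_subseq sub_qp)/Dp.
by move=> [p [/andP[wp _] Dp]]; exists p => //; apply/allP.
Qed.

Lemma connect_arcD1 D g x y :
  connect (arc D) x y ->
  connect (arc (D :\ g)) x y \/ connect (arc (D :\ g)) x (src g).
Proof.
case/connectP=> q; elim: q x => [|z q IHq] x /=; first by move=> _ ->; left.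
case/andP=> /arcP[e De [<- <-]] /IHq/[apply] connect_tgt.
have [->|e_neq_g] := eqVneq e g; first by right.
have step : connect (arc (D :\ g)) (src e) (tgt e).
  by apply/connect1/arc_edge; rewrite !inE e_neq_g.
by case: connect_tgt => [to_y|to_g]; [left | right]; apply: connect_trans step _.
Qed.

Definition in_root D v : bool := [forall x, connect (arc D) x v].

Definition out_root D v : bool := [forall x, connect (arc D) v x].

Definition downhill h D : {set edge G} := [set e in D | h (tgt e) < h (src e)].

Lemma in_root_downhill D v : in_root D v -> exists h, in_root (downhill h D) v.
Proof.
move=> /forallP/connect_descending_rank[h descend]; exists h; apply/forallP.
apply: (descending_rank_connect (h := h)) => x /descend[y /arcP[e De [se te]] hy].
by exists y => //; apply/arcP; exists e; rewrite // inE De se te.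
Qed.

Lemma in_root_downhill_section h D T v :
  in_root (downhill h D) v -> T \subset downhill h D ->
  @src G @: T = @src G @: downhill h D -> in_root T v.
Proof.
move=> /forallP to_v sub_T eq_src; apply/forallP.
apply: (descending_rank_connect (h := h)) => x xv.
have : x \in @src G @: downhill h D.
  have /connectP[[|y q] /=] := to_v x.
    by move=> _ def_v; rewrite def_v eqxx in xv.
  by case/andP=> /arcP[e De [<- _]] _ _; apply: imset_f.
rewrite -eq_src => /imsetP[e Te ->]; exists (tgt e); first exact: arc_edge.
by have := subsetP sub_T e Te; rewrite inE => /andP[].
Qed.

End Roots.

Definition reverse (G : multigraph) : multigraph := Multigraph (@tgt G) (@src G).

Lemma in_root_reverse (G : multigraph) (D : {set edge G}) (v : vertex G) :
  @in_root (reverse G) D v = out_root D v.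
Proof.
apply: eq_forallb => x.
have -> : connect (arc D) v x = connect [rel z y | arc D y z] x v.
  by rewrite connect_rev.
by apply: eq_connect => y z; apply: eq_existsb => e /=; rewrite [X in _ && X]andbC.
Qed.

(** * Arborescences *)

(* The walks in the definition of [uconnected] are walks of this multigraph. *)
Definition undirected (G : multigraph) : multigraph := Multigraph (@usrc G) (@utgt G).

Section Arborescence.
Variable G : multigraph.
Implicit Types (T D : {set edge G}) (v : vertex G) (h : vertex G -> nat).

Lemma in_root_uconnected T v : in_root T v -> uconnected T.
Proof.
move=> /forallP to_v a b.
pose uT : {set edge (undirected G)} := [set x | x.1 \in T].
have arc_uarc : subrel (arc T) (arc uT).
  by move=> x y /arcP[e Te [se te]]; apply/arcP; exists (e, true); rewrite ?inE.
have uarc_flip x y : arc uT x y -> arc uT y x.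
  case/arcP=> -[e d]; rewrite inE => Te [<- <-].
  by apply/arcP; exists (e, ~~ d); [rewrite inE | case: d Te].
have uarc_sym : connect_sym (arc uT).
  by apply: sym_connect_sym => x y; apply/idP/idP; apply: uarc_flip.
have uto_v x : connect (arc uT) x v.
  exact: (connect_sub (fun y z yz => connect1 (arc_uarc y z yz))) (to_v x).
have : connect (arc uT) a b by rewrite (connect_trans (uto_v a)) // uarc_sym.
case/connect_dipathP=> p [simple_p uTp]; exists p; split=> // e /mapP[x px ->].
by have := uTp x px; rewrite inE.
Qed.

(* Both edges of a cycle at a vertex where [h] is largest leave that vertex, hence
   coincide. *)
Lemma downhill_uacyclic h D T :
  T \subset downhill h D -> {in T &, injective (@src G)} -> uacyclic T.
Proof.
move=> /subsetP sub_T src_inj a c walk_c sub_c uniq_edges _; apply/eqP.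
apply/negPn/negP=> /(closed_walk_peak h walk_c).
have downT e d : (e, d) \in c -> e \in T /\ h (tgt e) < h (src e).
  by move=> /(map_f fst)/sub_c Te; have := sub_T e Te; rewrite inE => /andP[].
case=> -[e1 d1] [[e2 d2] [e1_c e2_c]].
have [Te1 down1] := downT _ _ e1_c; have [Te2 down2] := downT _ _ e2_c.
rewrite /usrc /utgt /=.
case: d1 e1_c => e1_c; first by rewrite [h _ <= _]leqNgt down1.
case: d2 e2_c => e2_c => [src12 _ _|_ _]; last by rewrite leqNgt down2.
by have [] := map_uniq_inj_in uniq_edges e1_c e2_c (src_inj _ _ Te1 Te2 src12).
Qed.

Lemma spanning_tree_into_in_root v T : spanning_tree_into v T -> in_root T v.
Proof. by case=> _ to_v; apply/forallP=> x; apply/connect_dipathP. Qed.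

Lemma in_root_spanning_tree_into D v :
  in_root D v -> exists2 T : {set edge G}, T \subset D & spanning_tree_into v T.
Proof.
move=> /in_root_downhill[h root_h].
have [T [sub_T src_inj eq_src]] := imset_section (@src G) (downhill h D).
have root_T := in_root_downhill_section root_h sub_T eq_src.
exists T.
  by apply: subset_trans sub_T _; apply/subsetP=> e; rewrite inE => /andP[].
split; first split.
- exact: in_root_uconnected root_T.
- exact: downhill_uacyclic sub_T src_inj.
- by move=> x; apply/connect_dipathP/(forallP root_T).
Qed.

End Arborescence.

(* Reversing all edges exchanges [usrc] with [utgt] up to conversion. *)
Lemma spanning_tree_reverse (G : multigraph) (T : {set edge G}) :
  @spanning_tree (reverse G) T -> spanning_tree T.
Proof.
have mem_unzip1_rev (p : seq (edge G * bool)) : unzip1 (rev p) =i unzip1 p.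
  by move=> e; rewrite /unzip1 map_rev mem_rev.
move=> [conn acy]; split=> [a b|a c walk_c sub_c uniq_edges uniq_vertices].
  have [p [/simple_path_rev simple_p sub_p]] := conn b a.
  by exists (rev p); split=> // e; rewrite mem_unzip1_rev; apply: sub_p.
suff : rev c = [::] by move/(congr1 rev); rewrite revK.
apply: (acy a); first exact: walk_rev walk_c.
- by move=> e; rewrite mem_unzip1_rev; apply: sub_c.
- by rewrite /unzip1 map_rev rev_uniq.
by rewrite map_rev rev_uniq (perm_uniq (closed_walk_vertices walk_c)).
Qed.

Lemma spanning_tree_from_reverse (G : multigraph) (v : vertex G) (T : {set edge G}) :
  @spanning_tree_into (reverse G) v T -> spanning_tree_from v T.
Proof.
case=> /spanning_tree_reverse tree_T to_v; split=> // x.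
have [p [/simple_path_rev simple_p sub_p]] := to_v x.
by exists (rev p); split=> // e; rewrite mem_rev; apply: sub_p.
Qed.

Lemma out_root_spanning_tree_from (G : multigraph) (D : {set edge G}) (v : vertex G) :
  out_root D v -> exists2 T : {set edge G}, T \subset D & spanning_tree_from v T.
Proof.
rewrite -in_root_reverse => /in_root_spanning_tree_into[T sub_T tree_T].
by exists T; last exact: spanning_tree_from_reverse.
Qed.

Lemma spanning_tree_from_out_root (G : multigraph) (v : vertex G) (T : {set edge G}) :
  spanning_tree_from v T -> out_root T v.
Proof. by case=> _ from_v; apply/forallP=> x; apply/connect_dipathP. Qed.

(** * From trees to routings *)

Lemma ranked_routing (G : multigraph) (rk : edge G -> nat) :
  (forall a b : vertex G,
    exists2 p, diwalk a p b & sorted (relpre rk ltn) p) ->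
  exists r : vertex G -> vertex G -> seq (edge G), is_routing r /\ deadlock_free r.
Proof.
move=> ranked_walk.
have rk_trans := relpre_trans (f := rk) ltn_trans.
have route a b : exists p, dipath a p b && sorted (relpre rk ltn) p.
  have [p /walk_shorten[q sub_qp simple_q] sorted_p] := ranked_walk a b.
  by exists q; rewrite /dipath simple_q (subseq_sorted rk_trans sub_qp).
exists (fun a b => xchoose (route a b)); split=> [a b _|].
  by case/andP: (xchooseP (route a b)).
apply: (ranked_acyclic (rk := rk)) => e1 e2 /existsP[a /existsP[b /andP[_]]].
by case/andP: (xchooseP (route a b)) => _ /sorted_infix2P; apply.
Qed.

Lemma downhill_sorted
    (G : multigraph) (h : vertex G -> nat) (D : {set edge G}) a p b :
  diwalk a p b -> all [in downhill h D] p ->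
  sorted [rel e1 e2 | h (src e2) < h (src e1)] p.
Proof.
move=> /walk_consecutive consecutive_p down_p.
apply: sub_in_sorted down_p consecutive_p.
by move=> e1 e2; rewrite !inE => /andP[_ down1] _ /= /eqP <-.
Qed.

Lemma roots_ranked_walk (G : multigraph) (v : vertex G) (Din Dout : {set edge G}) :
  [disjoint Din & Dout] -> in_root Din v -> out_root Dout v ->
  exists rk : edge G -> nat, forall a b : vertex G,
    exists2 p, diwalk a p b & sorted (relpre rk ltn) p.
Proof.
rewrite -in_root_reverse => disj.
move=> /in_root_downhill[hin to_v] /in_root_downhill[hout from_v].
pose top := \max_x hin x.
exists (fun e => if e \in Din then top - hin (src e)
                 else (top + hout (tgt e)).+1) => a b.
have /connect_arcP[p wp down_p] := forallP to_v a.
have /connect_arcP[q wq down_q] := forallP from_v b.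
exists (p ++ rev q); first exact: walk_cat wp (walk_rev wq).
have in_p e : e \in p -> e \in Din.
  by move=> /(allP down_p); rewrite inE => /andP[].
have in_q e : e \in rev q -> e \notin Din.
  rewrite mem_rev => /(allP down_q); rewrite inE => /andP[Dout_e _].
  by rewrite (disjointFl disj Dout_e).
have rk_trans rk := relpre_trans (f := rk) ltn_trans.
rewrite sorted_pairwise // pairwise_cat -!sorted_pairwise //; apply/and3P; split.
- apply/allrelP=> e1 e2 /in_p /= -> /in_q/negPf->.
  by rewrite ltnS (leq_trans (leq_subr _ _)) ?leq_addr.
- have := downhill_sorted wp down_p.
  apply: sub_in_sorted => [e1 e2 /in_p /= -> /in_p ->|].
    by move=> lt_h; apply: ltn_sub2l (leq_trans lt_h (leq_bigmax _)) lt_h.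
  exact/allP.
- have := downhill_sorted wq down_q; rewrite -rev_sorted.
  apply: sub_in_sorted => [e1 e2 /in_q/negPf /= -> /in_q/negPf->|].
    by rewrite ltnS ltn_add2l.
  exact/allP.
Qed.

(** * From routings to trees *)

Section Peeling.
Variables (G : multigraph) (dep : rel (edge G)).
Hypothesis dep_consecutive : subrel dep (consecutive (@src G) (@tgt G)).
Implicit Types (D : {set edge G}) (f g : edge G) (v : vertex G).

Lemma connect_dep_arcD1 D f g :
  down_closed dep D -> g \in D -> connect dep f g ->
  connect (arc (D :\ g)) (src f) (src g).
Proof.
move=> clD Dg /connectP[q]; elim: q f => [|e q IHq] f /=; first by move=> _ ->.
case/andP=> dep_fe dep_q def_g.
have [-> //|f_neq_g] := eqVneq f g.
have Df : f \in D.
  apply: down_closed_connect clD _ Dg; apply/connectP.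
  by exists (e :: q); rewrite /= ?dep_fe.
apply: connect_trans (IHq e dep_q def_g); rewrite -(eqP (dep_consecutive dep_fe)).
by apply/connect1/arc_edge; rewrite !inE f_neq_g.
Qed.

Lemma in_rootD1 D f g :
  down_closed dep D -> g \in D -> connect dep f g -> in_root D (src f) ->
  in_root (D :\ g) (src g).
Proof.
move=> clD Dg fg /forallP to_f; apply/forallP=> x.
have [to_src_f|//] := connect_arcD1 g (to_f x).
exact: connect_trans to_src_f (connect_dep_arcD1 clD Dg fg).
Qed.

Lemma down_closed_in_root_no_exit v0 :
  acyclic dep -> in_root setT v0 ->
  exists D v, [/\ down_closed dep D, in_root D v & {in D, forall e, src e != v}].
Proof.
move=> acy root_v0.
pose closed_rooted D := down_closed dep D && [exists v, in_root D v].
have : exists D, closed_rooted D.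
  exists setT; apply/andP; split; last by apply/existsP; exists v0.
  by apply/down_closedP=> x y _ _; rewrite inE.
case/ex_minset=> D /minsetP[/andP[clD /existsP[v root_v]] minD].
exists D, v; split=> // f Df; apply/eqP=> src_f.
have [g [Dg fg max_g]] := acyclic_maximal acy Df.
have : closed_rooted (D :\ g).
  rewrite /closed_rooted down_closedD1 //; apply/existsP; exists (src g).
  by apply: in_rootD1 fg _; rewrite ?src_f.
by move=> /minD/(_ (subD1set _ _))/setP/(_ g); rewrite !inE eqxx Dg.
Qed.

End Peeling.

Section DependencyGraph.
Variables (G : multigraph) (r : vertex G -> vertex G -> seq (edge G)).
Hypothesis routing_r : is_routing r.

Lemma dependency_sorted a b : a != b -> sorted (dependency r) (r a b).
Proof.
move=> ab; apply/sorted_infix2P=> e1 e2 inf; apply/existsP; exists a.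
by apply/existsP; exists b; rewrite ab.
Qed.

Lemma dependency_consecutive :
  subrel (dependency r) (consecutive (@src G) (@tgt G)).
Proof.
move=> e1 e2 /existsP[a /existsP[b /andP[ab]]].
case/andP: (routing_r ab) => /walk_consecutive consecutive_r _.
by move: e1 e2; apply/sorted_infix2P.
Qed.

Lemma no_exit_out_root (D : {set edge G}) (v : vertex G) :
  down_closed (dependency r) D -> {in D, forall e, src e != v} ->
  out_root (~: D) v.
Proof.
move=> clD no_exit; apply/forallP=> x.
have [-> //|xv] := eqVneq x v.
rewrite eq_sym in xv; case/andP: (routing_r xv) => walk_r _.
apply/connect_arcP; exists (r v x) => //; apply/allP.
case: (r v x) walk_r (dependency_sorted xv) => //= e p /andP[/eqP src_e _] dep_p.
move=> e' /(path_connect dep_p) ee'; rewrite inE; apply/negP=> De'.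
by have := no_exit e (down_closed_connect clD ee' De'); rewrite src_e eqxx.
Qed.

End DependencyGraph.

Lemma strongly_connected_in_root (G : multigraph) :
  strongly_connected G -> exists v : vertex G, in_root setT v.
Proof.
move=> [/card_gt0P[v _] sc]; exists v; apply/forallP=> x.
have [p dipath_p] := sc x v; apply/connect_dipathP.
by exists p; split=> // e; rewrite inE.
Qed.

Theorem theorem1 (G : multigraph) (hG : strongly_connected G) :
  (exists r : vertex G -> vertex G -> seq (edge G),
      is_routing r /\ deadlock_free r) <->
  (exists (v : vertex G) (Tin Tout : {set edge G}),
      [/\ [disjoint Tin & Tout],
          spanning_tree_into v Tin
        & spanning_tree_from v Tout]).
Proof.
split=> [[r [routing_r acyclic_r]]|[v [Tin [Tout [disj tree_in tree_out]]]]].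
  have [v0 root_v0] := strongly_connected_in_root hG.
  have [D [v [clD root_v no_exit]]] :=
    down_closed_in_root_no_exit (dependency_consecutive routing_r) acyclic_r root_v0.
  have [Tin sub_in tree_in] := in_root_spanning_tree_into root_v.
  have [Tout sub_out tree_out] :=
    out_root_spanning_tree_from (no_exit_out_root routing_r clD no_exit).
  exists v, Tin, Tout; split=> //; apply: disjointWl sub_in _.
  by rewrite disjoint_sym disjoints_subset.
have [rk] := roots_ranked_walk disj (spanning_tree_into_in_root tree_in)
               (spanning_tree_from_out_root tree_out).
exact: ranked_routing.
Qed.
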